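(* For every integer $n\geq 0$ and any indeterminate $y$, \begin{align*} \sum_{k=0}^{n}(-1)^{n-k}\binom{n}{k}Q_{n,k}(y+1)^{k}&=\sum_{k=0}^{n}\binom{n}{k}y^{k}I_{k},\\ \sum_{k=0}^{n}\binom{n}{k}Q_{n,k}\,y^{k} &= \sum_{k=0}^{n}(-1)^{n-k}\binom{n}{k}(y+1)^{k}I_{k},\\ \sum_{k=0}^{n}\binom{n}{k}Q_{n,k}\,y^{k} &= \sum_{k=0}^{\lfloor n/2\rfloor}\binom{n}{2k}(2k-1)!!\,y^{n-2k}(y+1)^{2k}. \end{align*}
   Context: An involution of a finite set is a permutation $\sigma$ with $\sigma^2=\mathrm{id}$. For $0\le k\le n$, $Q_{n,k}$ is the number of involutions of $[n+1]=\{1,\dots,n+1\}$ whose largest fixed point is $k+1$. $I_n$ is the number of involutions of $[n]$ ($I_0=1$). $(2k-1)!!=1\cdot3\cdots(2k-1)$ with $(-1)!!=1$. *)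

(* Defs.v *)
From mathcomp Require Import all_boot all_fingroup all_algebra.

Set Implicit Arguments.
Unset Strict Implicit.
Unset Printing Implicit Defensive.

(* The element j + 1 of [n] is represented by the ordinal j : 'I_n. *)

Definition involutions (n : nat) : {set {perm 'I_n}} :=
  [set s : {perm 'I_n} | (s ^+ 2 == 1)%g].

Definition involution_number (n : nat) : nat := #|involutions n|.

Definition largest_fixpoint (n : nat) (s : {perm 'I_n}) (i : 'I_n) : bool :=
  (s i == i) && [forall j : 'I_n, (s j == j) ==> (j <= i)].

(* Q_{n,k}: since indices are shifted by one, the condition "the largest fixed
   point is k + 1" in [n + 1] concerns the ordinal k. *)
Definition Q (n : nat) (k : 'I_n.+1) : nat :=
  #|[set s in involutions n.+1 | largest_fixpoint s k]|.

(* (2k - 1)!! = 1 * 3 * ... * (2k - 1); the empty product gives (-1)!! = 1. *)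
Definition odd_double_fact (k : nat) : nat := \prod_(i < k) (2 * i + 1).

(* Main.v *)
(* Sorting involutions by their set of moved points gives
   I_n = sum_j C(n,j) d_j and Q_{n,k} = sum_j C(k,j) d_{n-k+j}, where d_j is the
   number of fixed-point-free involutions of j points. Let L be the linear
   functional on polynomials with L(X^j) = d_j. Then I_k = L((X+1)^k) and
   Q_{n,k} = L((X+1)^k X^(n-k)), so by the binomial theorem the two sides of each
   identity are L applied to two expansions of one polynomial: (y(X+1) + 1)^n for
   the first, and ((y+1)(X+1) - 1)^n = (y + (y+1)X)^n for the other two. *)
Require Import Defs.
From mathcomp Require Import all_boot all_fingroup all_algebra.
From mathcomp Require Import ring zify.

Import GRing.Theory.
Local Open Scope ring_scope.

(** * Involutions with a prescribed set of moved points *)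

Section InvolutionsByMovedPoints.

Context {T : finType}.
Implicit Types (s : {perm T}) (A B S : {set T}).

Lemma perm_sqr_eq1P s : reflect (involutive s) (s ^+ 2 == 1)%g.
Proof.
apply: (iffP eqP) => [s2 x | sK].
  by rewrite -permM -[(s * s)%g]/(s ^+ 2)%g s2 perm1.
by apply/permP => x; rewrite expgS expg1 permM perm1 sK.
Qed.

Definition moved_points s : {set T} := [set x | s x != x].

Definition involutions_moving A : {set {perm T}} :=
  [set s : {perm T} | (s ^+ 2 == 1)%g & moved_points s == A].

Lemma involutions_movingP A s :
  reflect (involutive s /\ forall x, (s x != x) = (x \in A))
          (s \in involutions_moving A).
Proof.
rewrite inE; apply: (iffP andP) => [[/perm_sqr_eq1P sK /eqP <-] | [sK sA]].
  by split=> // x; rewrite inE.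
by split; [apply/perm_sqr_eq1P | apply/eqP/setP => x; rewrite inE sA].
Qed.

Lemma involutions_moving0 : involutions_moving set0 = [set 1%g].
Proof.
apply/setP => s; rewrite in_set1; apply/involutions_movingP/eqP => [[_ s0] | ->].
  by apply/permP => x; rewrite perm1; apply/eqP/negbFE; rewrite s0 inE.
by split=> x; rewrite !perm1 // eqxx inE.
Qed.

(** An involution sending [a] to [b] contains the 2-cycle (a b). Composing with [tperm a b] removes
    or restores that cycle and leaves every other point alone. *)
Lemma involutions_moving_swap A a b : a \in A -> b \in A -> b != a ->
  [set s in involutions_moving A | s a == b] =
  [set (s * tperm a b)%g | s in involutions_moving (A :\ a :\ b)].
Proof.
move=> aA bA neq_ba; apply/setP => s; rewrite inE.
apply/andP/imsetP => [[/involutions_movingP [sK sA] /eqP sa] | [t]].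
  have sb : s b = a by rewrite -sa sK.
  (* This witness is forced, since [tperm a b] is its own inverse. *)
  exists (s * tperm a b)%g; last by rewrite -mulgA tperm2 mulg1.
  have tE x : (s * tperm a b)%g x = if (x == a) || (x == b) then x else s x.
    rewrite permM; case: eqVneq => [-> | neq_xa]; first by rewrite sa tpermR.
    case: eqVneq => [-> | neq_xb]; first by rewrite sb tpermL.
    by rewrite tpermD // eq_sym; [rewrite -sb | rewrite -sa]; rewrite (inj_eq perm_inj).
  apply/involutions_movingP; split=> x; last first.
    rewrite tE !in_setD1; case: (x =P a) => [_ | _] /=.
      by rewrite eqxx andbF.
    by case: (x =P b) => [_ | _] /=; rewrite ?eqxx ?sA.
  rewrite !tE; case: (boolP ((x == a) || (x == b))) => [-> // | /norP [/negPf xa /negPf xb]].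
  have -> : (s x == a) = false by rewrite -sb (inj_eq perm_inj).
  by have -> : (s x == b) = false; rewrite ?sK // -sa (inj_eq perm_inj).
move=> /involutions_movingP [tK tA] ->.
have ta : t a = a by apply/eqP/negbFE; rewrite tA !in_setD1 eqxx andbF.
have tb : t b = b by apply/eqP/negbFE; rewrite tA !in_setD1 eqxx.
have sE x : (t * tperm a b)%g x =
    if x == a then b else if x == b then a else t x.
  rewrite permM; case: eqVneq => [-> | neq_xa]; first by rewrite ta tpermL.
  case: eqVneq => [-> | neq_xb]; first by rewrite tb tpermR.
  by rewrite tpermD // eq_sym; [rewrite -ta | rewrite -tb]; rewrite (inj_eq perm_inj).
split; last by rewrite sE eqxx.
apply/involutions_movingP; split=> x; rewrite !sE; last first.
  have [-> | neq_xa] := eqVneq x a; first by rewrite aA.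
  have [-> | neq_xb] := eqVneq x b; first by rewrite bA eq_sym neq_ba.
  by rewrite tA !in_setD1 neq_xa neq_xb.
have [-> | neq_xa] := eqVneq x a; first by rewrite (negPf neq_ba) eqxx.
have [-> | neq_xb] := eqVneq x b; first by rewrite eqxx.
have /negPf -> : t x != a by rewrite -ta (inj_eq perm_inj).
by have /negPf -> : t x != b; rewrite ?tK // -tb (inj_eq perm_inj).
Qed.

End InvolutionsByMovedPoints.

(** Closed form of d_j: the 2-cycles pair off all j points, so there are no such involutions for odd
    j and (j-1)!! of them for even j. *)
Definition fixfree_number (j : nat) : nat :=
  if odd j then 0%N else odd_double_fact j./2.

Lemma fixfree_numberSS j :
  fixfree_number j.+2 = (j.+1 * fixfree_number j)%N.
Proof.
rewrite /fixfree_number /= negbK; case: ifP => [_ | /negbT j_even].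
  by rewrite muln0.
by rewrite /odd_double_fact big_ord_recr /= mul2n even_halfK // addn1 mulnC.
Qed.

(** Fix a point [a] of [A] and sort by its partner [b]. Each of the |A| - 1 choices leaves an
    involution moving the other |A| - 2 points, which is the recurrence of [fixfree_numberSS]. *)
Lemma card_involutions_moving (T : finType) (A : {set T}) :
  #|involutions_moving A| = fixfree_number #|A|.
Proof.
have [m] := ubnP #|A|; elim: m A => // m IHm A ltAm.
have [-> | [a aA]] := set_0Vmem A.
  rewrite involutions_moving0 cards1 cards0 /fixfree_number /odd_double_fact.
  by rewrite big_ord0.
rewrite -sum1_card (partition_big (fun s : {perm T} => s a) [in A :\ a]) /=; last first.
  move=> s /involutions_movingP [sK sA].
  by rewrite in_setD1 -sA sK sA eq_sym sA aA.
have cardA := cardsD1 a A; rewrite aA in cardA.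
rewrite (eq_bigr (fun=> fixfree_number #|A|.-2)) => [|b]; last first.
  rewrite in_setD1 => /andP [neq_ba bA].
  have := cardsD1 b (A :\ a); rewrite in_setD1 neq_ba bA /= => cardAa.
  rewrite sum1dep_card involutions_moving_swap // card_imset; last exact: mulIg.
  by rewrite IHm; [congr fixfree_number; lia | lia].
(* If [A] is the singleton of [a], no partner exists and both sides are 0. *)
rewrite sum_nat_const; case: #|A :\ a| cardA => [|j] -> //.
by rewrite add1n fixfree_numberSS.
Qed.

Lemma card_involutions_moved_in (T : finType) (P : pred {set T}) :
  #|[set s : {perm T} | (s ^+ 2 == 1)%g & P (moved_points s)]| =
  (\sum_(A : {set T} | P A) fixfree_number #|A|)%N.
Proof.
rewrite -sum1_card (partition_big (moved_points (T := T)) P) /=; last first.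
  by move=> s; rewrite inE => /andP [].
apply: eq_bigr => A PA; rewrite sum1dep_card -card_involutions_moving.
apply: eq_card => s; rewrite !inE.
by case: (moved_points s =P A) => [-> | _]; rewrite ?PA ?andbT ?andbF.
Qed.

(** * Binomial sums for I_n and Q_{n,k} *)

Lemma sum_subset_card (T : finType) (S : {set T}) (f : nat -> nat) :
  (\sum_(B : {set T} | B \subset S) f #|B| =
   \sum_(j < #|S|.+1) 'C(#|S|, j) * f j)%N.
Proof.
(* The default value of [inord] never arises, as a subset of [S] has at most |S| elements. *)
rewrite (partition_big (fun B : {set T} => inord #|B| : 'I_#|S|.+1) predT) //=.
apply: eq_bigr => j _; rewrite -cards_draws -sum_nat_const.
apply: eq_big => [B | B /andP [sBS /eqP <-]]; last first.
  by rewrite inordK // ltnS subset_leq_card.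
rewrite inE; apply: andb_id2l => sBS.
by rewrite -val_eqE /= inordK // ltnS subset_leq_card.
Qed.

Lemma involution_numberE n :
  involution_number n = (\sum_(j < n.+1) 'C(n, j) * fixfree_number j)%N.
Proof.
have := sum_subset_card _ [set: 'I_n] fixfree_number; rewrite cardsT card_ord => <-.
rewrite -card_involutions_moved_in; apply: eq_card => s.
by rewrite !inE subsetT andbT.
Qed.

(** Puts the condition in a form depending only on the moved set, as [card_involutions_moved_in]
    requires. *)
Lemma largest_fixpoint_moved n (s : {perm 'I_n}) (k : 'I_n) :
  largest_fixpoint s k =
  (k \notin moved_points s)
  && ([set j : 'I_n | (k < j)%N] \subset moved_points s).
Proof.
rewrite /largest_fixpoint inE negbK; congr andb.
apply/forallP/subsetP => [sP j | sP j]; last first.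
  apply/implyP; rewrite leqNgt; apply: contraL => ltkj.
  by have := sP j; rewrite !inE; apply.
by rewrite !inE ltnNge; apply: contra => sj; apply: (implyP (sP j)).
Qed.

Lemma card_ord_lt n (k : 'I_n) : #|[set j : 'I_n | (j < k)%N]| = k.
Proof.
rewrite -sum1dep_card -(big_ord_widen _ (fun=> 1%N)) ?sum1_card ?card_ord //.
exact: ltnW.
Qed.

(** The admissible moved sets consist of all n - k points above [k] together with an arbitrary
    subset of the [k] points below it. *)
Lemma QE n (k : 'I_n.+1) :
  Q k = (\sum_(j < k.+1) 'C(k, j) * fixfree_number (n - k + j))%N.
Proof.
pose U := [set j : 'I_n.+1 | (k < j)%N]; pose S := [set j : 'I_n.+1 | (j < k)%N].
have cardU : #|U| = (n - k)%N.
  have := cardsC U; rewrite card_ord.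
  have -> : ~: U = k |: S by apply/setP => j; rewrite !inE -val_eqE /=; lia.
  by rewrite cardsU1 card_ord_lt inE ltnn /=; lia.
rewrite /Q -[in RHS](card_ord_lt _ k) -/S.
rewrite -(sum_subset_card _ S (fun j => fixfree_number (n - #|S| + j))) card_ord_lt.
transitivity (\sum_(A : {set 'I_n.+1} | (k \notin A) && (U \subset A))
                 fixfree_number #|A|)%N.
  rewrite -card_involutions_moved_in; apply: eq_card => s.
  by rewrite !inE largest_fixpoint_moved !inE.
have disjUS (B : {set 'I_n.+1}) : B \subset S -> B :&: U = set0.
  move=> /subsetP sBS; apply/setP => j; rewrite !inE; apply/negP => /andP [/sBS].
  by rewrite inE; lia.
(* An admissible set is determined by its part below [k], which can be any subset of [S]. *)
rewrite (reindex_onto (fun B => B :|: U) (fun A => A :&: S)) /=.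
  apply: eq_big => [B | B /andP [_ /eqP defB]].
    apply/andP/idP => [[_ /eqP <-] | sBS]; first exact: subsetIr.
    rewrite subsetUr andbT !inE ltnn orbF; split.
      by apply/negP => /(subsetP sBS); rewrite inE ltnn.
    rewrite setIUl (setIidPl sBS) setIC disjUS ?setU0 //.
  by rewrite cardsU disjUS ?cards0 ?cardU ?subn0 1?addnC // -defB subsetIr.
move=> A /andP [kA /subsetP sUA]; apply/setP => j; rewrite !inE.
have := sUA j; rewrite inE.
case: (ltngtP j k) => [_ _ | _ -> // | /val_inj ->].
  by rewrite andbT orbF.
by rewrite (negPf kA).
Qed.

(** * The linear functional and its values on products of powers of X + 1 and X *)

Section Moments.

Context {R : comNzRingType} (n : nat).
Implicit Types (p : {poly R}) (y c : R).

(* Truncating at degree n makes linearity immediate; only polynomials of degree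
   at most n are used. *)
Definition moment p : R := \sum_(i < n.+1) p`_i * (fixfree_number i)%:R.

Lemma moment_sum (I : finType) (F : I -> {poly R}) :
  moment (\sum_i F i) = \sum_i moment (F i).
Proof.
rewrite exchange_big /=; apply: eq_bigr => i _.
by rewrite coef_sum mulr_suml.
Qed.

Lemma momentZ c p : moment (c *: p) = c * moment p.
Proof. by rewrite mulr_sumr; apply: eq_bigr => i _; rewrite coefZ mulrA. Qed.

Lemma momentXn i : (i <= n)%N -> moment 'X^i = (fixfree_number i)%:R.
Proof.
move=> le_in; rewrite /moment (bigD1 (Ordinal (le_in : (i < n.+1)%N))) //=.
rewrite coefXn eqxx mul1r big1 ?addr0 // => j; rewrite -val_eqE /= => /negPf ne_ji.
by rewrite coefXn ne_ji mul0r.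
Qed.

Lemma moment_shifted k m : (k + m <= n)%N ->
  moment (('X + 1) ^+ k * 'X^m) =
  (\sum_(j < k.+1) 'C(k, j) * fixfree_number (m + j))%N%:R.
Proof.
move=> le_n; rewrite addrC exprDn mulr_suml moment_sum natr_sum.
apply: eq_bigr => j _; rewrite expr1n mul1r mulrnAl -exprD -scaler_nat momentZ.
by rewrite momentXn ?natrM 1?addnC //; have := ltn_ord j; lia.
Qed.

Lemma moment_involution_number k : (k <= n)%N ->
  moment (('X + 1) ^+ k) = (involution_number k)%:R.
Proof.
move=> le_kn; rewrite involution_numberE -[X in moment X]mulr1 -(expr0 'X).
by rewrite moment_shifted ?addn0.
Qed.

Lemma moment_Q (k : 'I_n.+1) :
  moment (('X + 1) ^+ k * 'X^(n - k)) = (Q k)%:R.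
Proof. by rewrite moment_shifted ?QE // subnKC // -ltnS. Qed.

End Moments.

Lemma big_ord_even (V : nmodType) (F : nat -> V) n :
  (forall i, odd i -> F i = 0) ->
  \sum_(i < n.+1) F i = \sum_(k < n./2.+1) F (2 * k)%N.
Proof.
move=> F_odd; elim: n => [|n IHn]; first by rewrite !big_ord1.
rewrite big_ord_recr IHn /= uphalf_half.
(* For even [n] the new term has odd index and vanishes; for odd [n] it is the one new even-indexed
   term. *)
have [odd_n | even_n] := boolP (odd n); last by rewrite F_odd //= addr0.
by rewrite [in RHS]big_ord_recr /=; congr (_ + F _); lia.
Qed.

Theorem theorem4p2 (R : comNzRingType) (y : R) (n : nat) :
  [/\ \sum_(k < n.+1)
         (-1) ^+ (n - k) * ('C(n, k))%:R * (Q k)%:R * (y + 1) ^+ k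
      = \sum_(k < n.+1) ('C(n, k))%:R * y ^+ k * (involution_number k)%:R,
      \sum_(k < n.+1) ('C(n, k))%:R * (Q k)%:R * y ^+ k
      = \sum_(k < n.+1)
         (-1) ^+ (n - k) * ('C(n, k))%:R * (y + 1) ^+ k
           * (involution_number k)%:R
    & \sum_(k < n.+1) ('C(n, k))%:R * (Q k)%:R * y ^+ k
      = \sum_(k < n./2.+1)
         ('C(n, 2 * k))%:R * (odd_double_fact k)%:R
           * y ^+ (n - 2 * k) * (y + 1) ^+ (2 * k)].
Proof.
have momentQ_exp (a b : R) :
    moment n ((b%:P * 'X + a%:P * ('X + 1)) ^+ n) =
    \sum_(k < n.+1) b ^+ (n - k) * ('C(n, k))%:R * (Q k)%:R * a ^+ k.
  rewrite exprDn moment_sum; apply: eq_bigr => k _; rewrite -moment_Q.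
  rewrite -!mulrA (mulrC _ (a ^+ k)) !mulrA -momentZ; congr (moment n _).
  rewrite !exprMn -!polyC_exp -mul_polyC !polyCM polyC_natr.
  by rewrite -mulr_natr; ring.
have momentI_exp (a b : R) :
    moment n ((b%:P + a%:P * ('X + 1)) ^+ n) =
    \sum_(k < n.+1)
       b ^+ (n - k) * ('C(n, k))%:R * a ^+ k * (involution_number k)%:R.
  rewrite exprDn moment_sum; apply: eq_bigr => k _.
  rewrite -(moment_involution_number n k (ltn_ord k)) -momentZ; congr (moment n _).
  rewrite !exprMn -!polyC_exp -mul_polyC !polyCM polyC_natr -mulr_natr; ring.
have sumQ : \sum_(k < n.+1) ('C(n, k))%:R * (Q k)%:R * y ^+ k =
    moment n (('X + y%:P * ('X + 1)) ^+ n).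
  have := momentQ_exp y 1; rewrite polyC1 mul1r => ->.
  by apply: eq_bigr => k _; rewrite expr1n mul1r.
split; last 2 first.
(* Taking b = -1 and a = y + 1 regroups X + y(X + 1) as (y + 1)(X + 1) - 1. *)
- rewrite sumQ -momentI_exp; congr (moment n (_ ^+ n)).
  by rewrite polyCN polyCD polyC1; ring.
- rewrite sumQ.
  (* In powers of X alone the moments are the numbers d_i, and only even i survive. *)
  have -> : 'X + y%:P * ('X + 1) = y%:P + (y + 1)%:P * 'X :> {poly R}.
    by rewrite polyCD polyC1; ring.
  rewrite exprDn moment_sum.
  pose F i := ('C(n, i))%:R * (fixfree_number i)%:R * y ^+ (n - i) * (y + 1) ^+ i.
  rewrite (eq_bigr (fun i : 'I_n.+1 => F i)) => [|i _]; last first.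
    rewrite /F -(momentXn n i (ltn_ord i)) -!mulrA (mulrC (moment _ _)) !mulrA -momentZ.
    congr (moment n _).
    by rewrite !exprMn -!polyC_exp -mul_polyC !polyCM polyC_natr -mulr_natr; ring.
  rewrite big_ord_even => [|i odd_i].
    apply: eq_bigr => k _.
    by rewrite /F /fixfree_number mul2n odd_double doubleK.
  by rewrite /F /fixfree_number odd_i mulr0 !mul0r.
(* Here b = -1 supplies the signs, and the base simplifies to 1 + y(X + 1). *)
- rewrite -momentQ_exp.
  have -> : (-1)%:P * 'X + (y + 1)%:P * ('X + 1) = 1%:P + y%:P * ('X + 1) :> {poly R}.
    by rewrite polyCN polyCD polyC1; ring.
  rewrite momentI_exp.
  by apply: eq_bigr => k _; rewrite expr1n mul1r.
Qed.
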